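(* If $L$ is a moment functional on $E$ and $L\neq0$, then $W(L)=V(L)$, that is, the set of atoms of representing measures of $L$ equals the core variety of $L$.
   Context: $\mathcal X$ is a locally compact Hausdorff space and $E$ is a finite-dimensional vector space of real-valued continuous functions on $\mathcal X$. A Radon measure on $\mathcal X$ is a (nonnegative) measure $\mu$ on the Borel $\sigma$-algebra with values in $[0,+\infty]$ such that $\mu(M)=\sup\{\mu(K):K\subseteq M,\ K\text{ compact}\}$ for every Borel set $M$. A linear functional $L$ on $E$ is a moment functional if there is a Radon measure $\mu$ on $\mathcal X$ such that all $f\in E$ are $\mu$-integrable and $L(f)=\int_{\mathcal X} f\,d\mu$ for all $f\in E$; any such $\mu$ is a representing measure of $L$, and $\mathcal M_L$ denotes the set of all representing measures. Define $W(L)=\{x\in\mathcal X:\mu(\{x\})>0\text{ for some }\mu\in\mathcal M_L\}$. Define inductively $V_0(L)=\mathcal X$ and, for $k\in\mathbb{N}=\{1,2,\dots\}$, $N_k(L)=\{p\in E: L(p)=0,\ p(x)\ge0\text{ for all }x\in V_{k-1}(L)\}$, $V_k(L)=\{t\in\mathcal X:p(t)=0\text{ for all }p\in N_k(L)\}$; if $V_k(L)$ is empty for some $k$, set $V_j(L)=\emptyset$ for all $j\ge k$. The core variety of $L$ is $V(L)=\bigcap_{k=0}^\infty V_k(L)$. *)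

(* Defs.v *)
From HB Require Import structures.
From mathcomp Require Import all_boot all_order all_algebra.
From mathcomp Require Import all_classical all_reals all_analysis.

Set Implicit Arguments.
Unset Strict Implicit.
Unset Printing Implicit Defensive.

Import Order.TTheory GRing.Theory Num.Theory.
Import numFieldNormedType.Exports.

Local Open Scope classical_set_scope.
Local Open Scope ring_scope.

(* Library sigma-algebras live on pointed types, hence [ptopologicalType]; the
   distinguished point is never used.  A nonzero functional on a space of
   functions on X exists only when X is nonempty. *)
Definition borel (X : ptopologicalType) := g_sigma_algebraType (@open X).

(* Only inner regularity is required: compact sets may have infinite measure. *)
Definition radon (R : realType) (X : ptopologicalType)
    (mu : {measure set (borel X) -> \bar R}) : Prop :=
  forall M : set (borel X), measurable M ->
    mu M = ereal_sup [set mu K | K in [set K : set X | compact K /\ K `<=` M]].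

Definition finite_dimensional (R : realType) (V : lmodType R) (E : set V) :
    Prop :=
  exists (n : nat) (b : 'I_n -> V), (forall i, E (b i)) /\
    forall v, E v -> exists c : 'I_n -> R, v = \sum_(i < n) c i *: b i.

(* Functionals on a subspace E are total functions of which only the values
   on E are ever considered. *)
Definition linear_on (R : realType) (V : lmodType R) (E : set V) (L : V -> R) :
    Prop :=
  forall (a : R) (u v : V), E u -> E v -> L (a *: u + v) = a * L u + L v.

Section CoreVariety.
Variables (R : realType) (X : ptopologicalType).
Variables (E : set (X -> R)) (L : (X -> R) -> R).

Definition representing (mu : {measure set (borel X) -> \bar R}) : Prop :=
  radon mu /\
  forall f : X -> R, E f ->
    mu.-integrable [set: borel X] (EFin \o f) /\
    ((L f)%:E = \int[mu]_x (f x)%:E)%E.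

Definition moment_functional : Prop :=
  exists mu : {measure set (borel X) -> \bar R}, representing mu.

Definition atoms : set X :=
  [set x | exists2 mu : {measure set (borel X) -> \bar R},
             representing mu & (0 < mu [set x])%E].

Definition null_nonneg_on (S : set X) : set (X -> R) :=
  [set p | [/\ E p, L p = 0 & forall x, S x -> 0 <= p x]].

(* The emptiness test is not redundant: [null_nonneg_on set0] is the kernel of
   L in E, whose elements may have common zeros. *)
Fixpoint core_step (k : nat) : set X :=
  if k is j.+1 then
    if core_step j == set0 then set0
    else [set t | forall p, null_nonneg_on (core_step j) p -> p t = 0]
  else [set: X].

Definition core_variety : set X := \bigcap_k core_step k.

End CoreVariety.

(* Main.v *)
Require Import Defs.
From HB Require Import structures.
From mathcomp Require Import all_boot all_order all_algebra.
From mathcomp Require Import all_classical all_reals all_analysis.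
From mathcomp Require Import measurable_realfun.

(** A representing measure mu is carried by every V_k: if it is carried by V_k,
    a p in N_(k+1) is nonnegative mu-a.e. with zero integral, so p vanishes
    mu-a.e., and inner regularity handles all such p at once.  Hence the atoms
    lie in the core variety.

    Conversely, the V_k form a decreasing chain of zero sets of functions in a
    finite-dimensional space, so V_k = V_(k+1) =: V for some k.  Then L is
    strictly positive on the nonzero restrictions to V of functions of E that
    are nonnegative on V.  Therefore L lies in the interior of the cone
    generated by the evaluations at points of V: compactness of the unit sphere
    reduces V to finitely many points, and Farkas' lemma applies.  So for each
    x in V and small e > 0 the functional L - e * delta_x is still a nonnegative
    combination of evaluations, and L has a finitely atomic representing measure
    charging x. *)

Set Implicit Arguments.
Unset Strict Implicit.

Import Order.TTheory GRing.Theory Num.Theory.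
Import numFieldNormedType.Exports.

Local Open Scope classical_set_scope.
Local Open Scope ring_scope.

(** * Farkas' lemma over an ordered field *)

Lemma mul_row_col_ge0 (R : realFieldType) (k : nat) (u : 'rV[R]_k)
    (l : 'cV[R]_k) :
  (forall j, 0 <= u 0 j) -> (forall j, 0 <= l j 0) -> 0 <= (u *m l) 0 0.
Proof.
by move=> u0 l0; rewrite mxE; apply: sumr_ge0 => j _; exact: mulr_ge0.
Qed.

(** Induction on the number of columns: [y] either lies in the cone of the last [k] columns, or
    everything is first projected along the first column. *)
Lemma farkas (R : realFieldType) (m k : nat) (A : 'M[R]_(m, k)) (y : 'cV[R]_m) :
  (forall x : 'rV[R]_m,
     (forall j, 0 <= (x *m A) 0 j) -> 0 <= (x *m y) 0 0) ->
  exists2 l : 'cV[R]_k, forall j, 0 <= l j 0 & y = A *m l.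
Proof.
elim: k A y => [|k IH] A y Ay.
  exists 0 => [[]//|]; rewrite mulmx0; apply/matrixP => i j.
  rewrite ord1 mxE; apply/eqP; rewrite eq_le.
  have d (c : R) : 0 <= c * y i 0.
    have := Ay (c *: delta_mx 0 i) (ltac:(case => //)).
    by rewrite -scalemxAl -rowE !mxE.
  by have := d 1; have := d (-1); rewrite mulN1r oppr_ge0 mul1r => -> ->.
move: A Ay; rewrite -[k.+1]/(1 + k)%N => A.
rewrite -[A]hsubmxK; move: (lsubmx A) (rsubmx A) => a B Ay {A}.
have [By|] := pselect (forall x : 'rV[R]_m,
     (forall j, 0 <= (x *m B) 0 j) -> 0 <= (x *m y) 0 0).
  have [l l0 ->] := IH _ _ By; exists (col_mx 0 l).
    by move=> j; rewrite mxE; case: splitP => i _; rewrite ?mxE.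
  by rewrite mul_row_col mulmx0 add0r.
move=> /existsNP[x0 /not_implyP[x0B /negP]]; rewrite -ltNge => x0y.
have Ay' (x : 'rV_m) : (forall j, 0 <= (x *m B) 0 j) -> 0 <= (x *m a) 0 0 ->
    0 <= (x *m y) 0 0.
  move=> xB xa; apply: Ay => j; rewrite mul_mx_row mxE.
  by case: splitP => i _; rewrite // ord1.
set s := (x0 *m a) 0 0.
have s0 : s < 0 by rewrite ltNge; apply/negP => /(Ay' _ x0B); rewrite leNgt x0y.
(* Bartl's induction: [P] projects columns along the generator [a], which it
   kills, onto the orthogonal of [x0]. *)
pose P : 'M[R]_m := 1%:M - s^-1 *: (a *m x0).
have Pa : P *m a = 0.
  rewrite mulmxBl mul1mx -scalemxAl -mulmxA [x0 *m a]mx11_scalar -/s.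
  by rewrite mul_mx_scalar scalerA mulVf ?lt_eqF// scale1r subrr.
have [|l l0 Pyl] := IH (P *m B) (P *m y).
  move=> x xPB; rewrite mulmxA; apply: Ay' => [j|]; first by rewrite -mulmxA.
  by rewrite -mulmxA Pa mulmx0 mxE.
(* [P] kills [y - B *m l], which therefore equals [a *m c]. The sign of [c] is right because [s < 0]
   and [x0] is negative on [y] but nonnegative on [B *m l]. *)
pose c : 'cV[R]_1 := s^-1 *: (x0 *m (y - B *m l)).
exists (col_mx c l).
  move=> j; rewrite mxE; case: splitP => i _ //; rewrite ord1 /c mxE.
  rewrite mulr_le0 ?invr_le0 ?(ltW s0)// mulmxBr mxE.
  rewrite [X in _ + X]mxE subr_le0 (le_trans (ltW x0y))// mulmxA.
  exact: mul_row_col_ge0.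
rewrite mul_row_col; apply/eqP; rewrite -subr_eq; apply/eqP.
have : P *m (y - B *m l) = 0 by rewrite mulmxBr Pyl mulmxA subrr.
rewrite mulmxBl mul1mx => /eqP; rewrite subr_eq0 => /eqP ->.
by rewrite /c -scalemxAr -scalemxAl mulmxA.
Qed.

(** * Interior points of a convex cone *)

Lemma mulmx_cV_continuous (R : realType) (m : nat) (w : 'cV[R]_m) :
  continuous (fun c : 'rV[R]_m => (c *m w) 0 0).
Proof.
have -> : (fun c : 'rV[R]_m => (c *m w) 0 0) =
    \sum_(i < m) (fun c : 'rV[R]_m => c 0 i * w i 0).
  by apply/funext => c; rewrite fct_sumE mxE.
apply: (big_ind (fun f : 'rV[R]_m -> R => continuous f)).
- exact: cst_continuous.
- by move=> f g cf cg c; apply: continuousD; [exact: cf|exact: cg].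
- move=> i _ c; apply: continuousM; last exact: cst_continuous.
  exact: coord_continuous.
Qed.

(* A vector on which every nonzero functional that is nonnegative on the cone
   spanned by the [v t] is positive is interior to this cone. *)
Lemma cone_interior (R : realType) (T : choiceType) (m : nat) (V : set T)
    (v : T -> 'cV[R]_m) (y : 'cV[R]_m) (x : T) :
  V x ->
  (forall c : 'rV[R]_m, c != 0 ->
     (forall t, V t -> 0 <= (c *m v t) 0 0) -> 0 < (c *m y) 0 0) ->
  exists (k : nat) (t : 'I_k -> T) (l : 'I_k -> R) (e : R),
    [/\ 0 < e, forall j, V (t j), forall j, 0 <= l j
      & y = e *: v x + \sum_(j < k) l j *: v (t j)].
Proof.
move=> Vx ypos.
have subE (a : R) (c : 'rV[R]_m) :
    (c *m (a *: y - v x)) 0 0 = a * (c *m y) 0 0 - (c *m v x) 0 0.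
  by rewrite mulmxBr -scalemxAr mxE [X in X + _]mxE [X in _ + X]mxE.
pose K := [set c : 'rV[R]_m | `|c| = 1].
(* A [c] on the sphere is either negative at some [v t] or, by [ypos], positive on [n *: y - v x]
   for large [n]. Indexing by pairs lets one finite subcover yield both the points and the
   multipliers. *)
pose U (nt : nat * T) := [set c : 'rV[R]_m | (c *m v nt.2) 0 0 < 0] `|`
  [set c : 'rV[R]_m | 0 < (c *m (nt.1%:R *: y - v x)) 0 0].
have cK : compact K.
  apply: bounded_closed_compact.
    by exists 1; split => // M M1 c /= ->; exact: ltW.
  apply: (@preimage_closed _ _ (fun c : 'rV[R]_m => `|c|) [set 1]).
    by move=> c _; exact: norm_continuous.
  exact: closed_eq.
move: cK; rewrite compact_cover => cK.
have [||D DV KD] := cK (nat * T)%type [set nt | V nt.2] U.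
- move=> [n t] _; apply: openU.
    apply: (@open_comp _ _ _ [set r : R | r < 0]) (@open_lt _ _).
    by move=> c _; exact: mulmx_cV_continuous.
  apply: (@open_comp _ _ _ [set r : R | 0 < r]) (@open_gt _ _).
  by move=> c _; exact: mulmx_cV_continuous.
- move=> c c1.
  have [cV|] := pselect (forall t, V t -> 0 <= (c *m v t) 0 0); last first.
    move=> /existsNP[t /not_implyP[Vt /negP]]; rewrite -ltNge.
    by exists (0, t); last left.
  have c0 : c != 0 by rewrite -normr_eq0 c1 oner_eq0.
  have := ypos _ c0 cV; set z := (c *m y) 0 0 => z0.
  exists (Num.bound ((c *m v x) 0 0 / z), x) => //; right => /=.
  rewrite subE subr_gt0 -/z -ltr_pdivrMr//.
  exact: unstable.ltr_bound.
pose s : seq (nat * T) := finmap.enum_fset D.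
pose N := (\sum_(nt <- s) nt.1)%N.
pose t (j : 'I_(size s)) := (tnth (in_tuple s) j).2.
pose A := \matrix_(i < m, j < 1 + size s)
  (if fintype.split j is inr j then v (t j) i 0 else v x i 0).
have AE c j : (c *m A) 0 j =
    (c *m (if fintype.split j is inr j then v (t j) else v x)) 0 0.
  by rewrite !mxE; apply: eq_bigr => i _; rewrite !mxE; case: (fintype.split j).
(* [v x] is kept among the generators: [c] nonnegative there is also nonnegative on [y], so a bound
   with some [n] of the subcover passes to [N.+1], which is moreover invertible. *)
have [c cA|l l0 yE] := @farkas R m _ A (N.+1%:R *: y - v x).
  have [->|c0] := eqVneq c 0; first by rewrite mul0mx mxE.
  have cx : 0 <= (c *m v x) 0 0.
    by have := cA (lshift _ ord0); rewrite AE (unsplitK (inl _)).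
  have ct j : 0 <= (c *m v (t j)) 0 0.
    by have := cA (rshift _ j); rewrite AE (unsplitK (inr _)).
  have n0 : 0 < `|c| by rewrite normr_gt0.
  have /KD : K (`|c|^-1 *: c).
    by rewrite /K /= normrZ normfV normr_id mulVf// gt_eqF.
  move=> [[n r] Dns] []/=; rewrite -scalemxAl mxE.
    rewrite pmulr_rlt0 ?invr_gt0// => cs; exfalso.
    have sD : (index (n, r) s < size s)%N by rewrite index_mem.
    have := ct (Ordinal sD); rewrite /t (tnth_nth (n, r)) /= nth_index//.
    by rewrite leNgt cs.
  rewrite pmulr_rgt0 ?invr_gt0// subE subr_gt0 => nxy.
  rewrite subE subr_ge0 (le_trans (ltW nxy))//.
  have y0 : 0 <= (c *m y) 0 0.
    rewrite leNgt; apply/negP => /ltW cy.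
    by have := le_lt_trans cx nxy; rewrite ltNge mulr_ge0_le0.
  rewrite ler_wpM2r// ler_nat (leq_trans _ (leqnSn _))//.
  by rewrite /N (big_rem (n, r))//= leq_addr.
pose e : R := N.+1%:R^-1.
have e0 : 0 < e by rewrite invr_gt0 ltr0n.
exists (size s), t, (fun j => e * l (rshift 1 j) 0),
  (e * (1 + l (lshift _ 0) 0)).
split=> //.
- by rewrite mulr_gt0// ltr_wpDr.
- by move=> j; have /DV := mem_tnth j (in_tuple s); rewrite inE.
- by move=> j; rewrite mulr_ge0// ltW.
- have -> : y = e *: (v x + A *m l).
    by rewrite -yE addrC subrK scalerA mulVf ?scale1r// pnatr_eq0.
  have -> : A *m l =
      l (lshift _ 0) 0 *: v x + \sum_(j < size s) l (rshift 1 j) 0 *: v (t j).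
    apply/matrixP => i j; rewrite ord1 !mxE summxE big_split_ord/= big_ord1.
    rewrite mxE (unsplitK (inl _)) mulrC; congr (_ + _).
    by apply: eq_bigr => r _; rewrite !mxE (unsplitK (inr _)) mulrC.
  rewrite addrA -[X in X + _ + _]scale1r -scalerDl scalerDr scalerA scaler_sumr.
  by congr (_ + _); apply: eq_bigr => j _; rewrite scalerA.
Qed.

(** * Finite-dimensional spaces of functions *)

Lemma restricted_basis (R : realType) (T : Type) (E : set (T -> R))
    (V : set T) :
  finite_dimensional E ->
  exists (m : nat) (b : 'I_m -> T -> R),
    [/\ forall i, E (b i),
        forall f, E f -> exists c : 'rV[R]_m,
          forall t, V t -> f t = \sum_(i < m) c 0 i * b i t
      & forall c : 'rV[R]_m,
          (forall t, V t -> \sum_(i < m) c 0 i * b i t = 0) -> c = 0].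
Proof.
move=> [n0 [b0 [Eb0 sb0]]].
pose spans m := exists b : 'I_m -> T -> R, (forall i, E (b i)) /\
  forall f, E f -> exists c : 'rV[R]_m,
    forall t, V t -> f t = \sum_(i < m) c 0 i * b i t.
have spans_n0 : exists m, `[< spans m >].
  exists n0; apply/asboolP; exists b0; split=> // f /sb0[c ->].
  exists (\row_i c i) => t _; rewrite fct_sumE.
  by apply: eq_bigr => i _; rewrite mxE.
(* Minimal length forces independence: a relation with [c 0 j != 0] lets [b j] be dropped. Only
   restrictions to [V] count, since nonzero functions of [E] may vanish on [V]. *)
case: (ex_minnP spans_n0) => m /asboolP[b [Eb sb]] m_min.
exists m, b; split=> // c cb; apply/eqP; apply: contraT => /rV0Pn[j cj0].
case: m j b c Eb sb m_min cb cj0 => [[]//|m] j b c Eb sb m_min cb cj0.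
suff /asboolP/m_min : spans m by rewrite ltnn.
exists (fun i => b (lift j i)); split=> // f /sb[d fd].
exists (\row_i (d 0 (lift j i) - d 0 j / c 0 j * c 0 (lift j i))) => t Vt.
have := cb t Vt; rewrite (bigD1_ord j)//= => /eqP.
rewrite addr_eq0 => /eqP cbj.
rewrite fd// (bigD1_ord j)//= -[in X in X + _](divfK cj0 (d 0 j)).
rewrite -[_ * b j t]mulrA cbj mulrN mulr_sumr.
rewrite addrC -sumrB; apply: eq_bigr => i _.
by rewrite mxE mulrBl [X in _ - X]mulrA.
Qed.

(** The square matrix of the first [n.+1] functions at the first [n.+1] points would be triangular
    and invertible, yet it factors through [n] spanning functions. *)
Lemma finite_dimensional_no_triangular (R : realType) (T : Type)
    (E : set (T -> R)) (p : nat -> T -> R) (t : nat -> T) :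
  finite_dimensional E -> (forall k, E (p k)) ->
  (forall k, p k (t k) != 0) ->
  ~ (forall i k, (i < k)%N -> p i (t k) = 0).
Proof.
move=> [n [b [_ sb]]] Ep pt pt0.
have [c pc] := choice (fun k => sb _ (Ep k)).
pose M := \matrix_(i < n.+1, k < n.+1) p i (t k).
pose C := \matrix_(i < n.+1, j < n) c i j.
pose B := \matrix_(j < n, k < n.+1) b j (t k).
have ME : M = C *m B.
  apply/matrixP => i k; rewrite !mxE pc fct_sumE.
  by apply: eq_bigr => j _; rewrite !mxE.
have Mu : M \in unitmx.
  rewrite unitmxE unitfE det_trig; last first.
    by apply/is_trig_mxP => i k ik; rewrite mxE pt0.
  by apply/prodf_neq0 => i _; rewrite mxE.
have := leq_trans (mxrankM_maxl C B) (rank_leq_col C).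
by rewrite -ME mxrank_unit// ltnn.
Qed.

(** * The decreasing chain of core steps *)

Section CoreStep.
Variables (R : realType) (X : ptopologicalType).
Variables (E : set (X -> R)) (L : (X -> R) -> R).

Lemma core_stepS k : core_step E L k != set0 ->
  core_step E L k.+1 =
  [set t | forall p, null_nonneg_on E L (core_step E L k) p -> p t = 0].
Proof. by move=> /negbTE /= ->. Qed.

(** Shrinking the set enlarges [null_nonneg_on], which shrinks its common zero set. *)
Lemma core_step_subset k : core_step E L k.+1 `<=` core_step E L k.
Proof.
elim: k => [//|k IH].
have [k0|k0] := eqVneq (core_step E L k.+1) set0.
  by rewrite [core_step _ _ k.+2]/= -/(core_step E L k.+1) k0 eqxx.
have k0' : core_step E L k != set0.
  by apply: contraNneq k0 => k0 /=; rewrite k0 eqxx.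
rewrite core_stepS// [X in _ `<=` X]core_stepS// => t /= pt p [Ep Lp p0].
by apply: pt; split=> // x /IH; exact: p0.
Qed.

Lemma core_step_subset_le i k : (i <= k)%N ->
  core_step E L k `<=` core_step E L i.
Proof.
move=> /subnK <-; elim: (k - i)%N => [//|j IH] t; rewrite addSn.
by move=> /core_step_subset /IH.
Qed.

(** If every inclusion were strict, some p_k in N_(k+1) would be nonzero at some t_k in V_k. For i <
    k, p_i vanishes on V_(i+1), which contains t_k: the forbidden triangular pattern. *)
Lemma core_step_stable : finite_dimensional E ->
  core_variety E L !=set0 ->
  exists k, core_step E L k `<=` core_step E L k.+1.
Proof.
move=> fE [x0 x0V]; apply: contrapT => /forallNP H.
have k0 k : core_step E L k != set0 by apply/set0P; exists x0; exact: x0V.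
have H' k : exists pt : (X -> R) * X,
    [/\ null_nonneg_on E L (core_step E L k) pt.1,
        core_step E L k pt.2 & pt.1 pt.2 != 0].
  have /existsNP[t /not_implyP[tk]] := H k.
  rewrite core_stepS//= => /existsNP[p /not_implyP[pk /eqP pt]].
  by exists (p, t).
have [pt ptP] := choice H'.
apply: (@finite_dimensional_no_triangular R X E (fun k => (pt k).1)
  (fun k => (pt k).2)) => // [k|k|i k ik].
- by have [[]] := ptP k.
- by have [] := ptP k.
- have [_ tk _] := ptP k; have [pi _ _] := ptP i.
  have := @core_step_subset_le i.+1 k ik _ tk.
  by rewrite core_stepS//; exact.
Qed.

End CoreStep.

(** * Negligible sets of Borel and Radon measures *)

Section BorelMeasure.
Variables (R : realType) (X : ptopologicalType).

Lemma open_borel (U : set X) : open U -> measurable (U : set (borel X)).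
Proof. exact: sub_sigma_algebra. Qed.

Lemma compact_borel (K : set X) : hausdorff_space X -> compact K ->
  measurable (K : set (borel X)).
Proof.
move=> hX cK; rewrite -[K]setCK; apply: measurableC.
by apply: open_borel; apply: closed_openC; exact: compact_closed.
Qed.

Lemma continuous_borel (f : X -> R) : continuous f ->
  measurable_fun [set: borel X] f.
Proof.
move=> /continuousP cf; apply: (measurability _ (RGenOpens.measurableE R)).
move=> _ [_ [a [b ->] <-]]; rewrite setTI; apply: open_borel.
exact/cf/interval_open.
Qed.

Lemma open_neq0 (p : X -> R) : continuous p -> open [set x | p x != 0].
Proof. by move=> /continuousP cp; exact: (cp _ (open_neq (y := 0))). Qed.

Variable mu : {measure set (borel X) -> \bar R}.

(* Inner regularity reduces an arbitrary family to a finite one. *)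
Lemma radon_common_zeros (N : set (X -> R)) :
  hausdorff_space X -> radon mu -> (forall p, N p -> continuous p) ->
  (forall p, N p -> mu.-negligible [set x | p x != 0]) ->
  mu.-negligible (~` [set t | forall p, N p -> p t = 0]).
Proof.
move=> hX rmu cN N0.
have UE : ~` [set t | forall p, N p -> p t = 0] =
    \bigcup_(p in N) [set x | p x != 0].
  apply/seteqP; split => t /=.
    by move=> /existsNP[p /not_implyP[Np /eqP pt]]; exists p.
  by move=> [p Np /eqP pt] /(_ p Np).
rewrite UE; set U := \bigcup_(p in N) _.
have mU : measurable (U : set (borel X)).
  by apply: open_borel; apply: bigcup_open => p Np; exact/open_neq0/cN.
exists U; split=> //; apply/eqP; rewrite eq_le measure_ge0 andbT.
rewrite (rmu _ mU); apply: ge_ereal_sup => _ [K [cK KU] <-].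
move: (cK); rewrite compact_cover => /(_ (X -> R : choiceType) N
  (fun p => [set x | p x != 0])) [p Np|//|D DN KD].
  exact/open_neq0/cN.
suff nK : mu.-negligible (K : set (borel X)).
  by rewrite (measure_negligible (compact_borel hX cK) nK).
apply: (@negligibleS _ (borel X) R mu _ K KD); rewrite /cover bigcup_fset.
rewrite big_seq; elim/big_ind: _.
- exact: negligible_set0.
- exact: (@negligibleU _ (borel X) R mu).
- by move=> p /DN; rewrite inE; exact: N0.
Qed.

Lemma ae_ge0_integral (S : set X) (p : X -> R) :
  mu.-negligible (~` S) -> (forall x, S x -> 0 <= p x) -> continuous p ->
  (\int[mu]_x (p x)%:E = \int[mu]_x `|(p x)%:E|)%E.
Proof.
move=> S0 p0 cp.
have mp : measurable_fun [set: borel X] (EFin \o p).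
  by apply/measurable_EFinP; exact: continuous_borel.
apply: ae_eq_integral => //; first exact: measurableT_comp.
apply: negligibleS S0 => x /= /not_implyP[_ px] Sx; apply: px.
by rewrite ger0_norm// p0.
Qed.

Lemma ae_integral_eq0 (S : set X) (p : X -> R) :
  mu.-negligible (~` S) -> (forall x, S x -> 0 <= p x) -> continuous p ->
  (\int[mu]_x (p x)%:E = 0)%E -> mu.-negligible [set x | p x != 0].
Proof.
move=> S0 p0 cp; rewrite (ae_ge0_integral S0)// => ip.
have mp : measurable_fun [set: borel X] (EFin \o p).
  by apply/measurable_EFinP; exact: continuous_borel.
have := (ae_eq_integral_abs mu measurableT mp).1 ip.
apply: negligibleS => x /= /eqP px; apply/not_implyP; split => //.
by move=> [].
Qed.

End BorelMeasure.

(** * Finite sums of point masses *)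

Section AtomicMeasure.
Local Open Scope ereal_scope.
Variables (R : realType) (X : ptopologicalType) (k : nat).
Variables (t : nat -> X) (l : nat -> {nonneg R}).

(** Indexing by [nat] fits [msum], which sums the first [k] terms. *)
Definition weighted_dirac (i : nat) : {measure set (borel X) -> \bar R} :=
  mscale (l i) (dirac (t i : borel X)).

Definition atomic_measure : {measure set (borel X) -> \bar R} :=
  msum weighted_dirac k.

Lemma atomic_measureE A : atomic_measure A =
  \sum_(i < k) (l i)%:num%:E * (\1_A (t i))%:E.
Proof. by []. Qed.

(** The points [t i], [i < k], lying in [M] form a finite, hence compact, subset with the same mass
    as [M]. *)
Lemma atomic_measure_radon : radon atomic_measure.
Proof.
move=> M mM; apply/eqP; rewrite eq_le; apply/andP; split.
  apply: ereal_sup_ubound; exists (M `&` [set t i | i in `I_k]).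
    split=> [|x []//]; apply: finite_compact; apply: finite_setIr.
    exact/finite_image/finite_II.
  rewrite !atomic_measureE; apply: eq_bigr => i _; rewrite !indicE in_setI.
  by rewrite [X in _ && X]mem_set ?andbT//=; exists i.
apply: ge_ereal_sup => _ [K [_ KM] <-]; rewrite !atomic_measureE.
apply: lee_sum => i _; apply: lee_wpmul2l => //.
rewrite lee_fin !indicE ler_nat; case: (boolP (_ \in K)) => // /set_mem /KM.
by move=> /mem_set ->.
Qed.

Lemma ge0_integral_atomic_measure (f : X -> \bar R) :
  measurable_fun [set: borel X] f -> (forall x, 0 <= f x) ->
  \int[atomic_measure]_x f x = \sum_(i < k) (l i)%:num%:E * f (t i).
Proof.
move=> mf f0; rewrite ge0_integral_measure_sum//; apply: eq_bigr => i _.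
by rewrite ge0_integral_mscale// integral_dirac// diracT mul1e.
Qed.

Lemma integrable_atomic_measure (f : X -> R) :
  measurable_fun [set: borel X] f ->
  atomic_measure.-integrable [set: borel X] (EFin \o f).
Proof.
move=> mf; apply/integrableP; split; first exact/measurable_EFinP.
rewrite ge0_integral_atomic_measure//; last first.
  by apply: measurableT_comp => //; exact/measurable_EFinP.
by apply: lte_sum_pinfty => i _; rewrite /= -EFinM ltry.
Qed.

Lemma integral_atomic_measure (f : X -> R) :
  measurable_fun [set: borel X] f ->
  \int[atomic_measure]_x (f x)%:E = (\sum_(i < k) (l i)%:num * f (t i))%:E.
Proof.
move=> mf; have mf' : measurable_fun [set: borel X] (EFin \o f).
  exact/measurable_EFinP.
rewrite integralE !ge0_integral_atomic_measure//; last 2 first.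
- exact: measurable_funeneg.
- exact: measurable_funepos.
have -> : \sum_(i < k) (l i)%:num%:E * (EFin \o f)^\+ (t i) =
    (\sum_(i < k) (l i)%:num * f^\+ (t i))%:E.
  by rewrite -sumEFin; apply: eq_bigr => i _; rewrite EFinM funeposE EFin_max.
have -> : \sum_(i < k) (l i)%:num%:E * (EFin \o f)^\- (t i) =
    (\sum_(i < k) (l i)%:num * f^\- (t i))%:E.
  rewrite -sumEFin; apply: eq_bigr => i _.
  by rewrite EFinM funenegE EFin_max.
rewrite -EFinB -sumrB; congr (_%:E); apply: eq_bigr => i _.
by rewrite -mulrBr -[in RHS](funrposBneg f).
Qed.

End AtomicMeasure.

(** * Carriers of a representing measure *)

Section Representing.
Variables (R : realType) (X : ptopologicalType).
Hypothesis X_hausdorff : hausdorff_space X.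
Variables (E : set (X -> R)) (L : (X -> R) -> R).
Hypothesis E_continuous : forall f : X -> R, E f -> continuous f.
Variable mu : {measure set (borel X) -> \bar R}.
Hypothesis mu_representing : representing E L mu.

(** Allows [L] to be computed from restrictions to a carrier of [mu], which is all that coordinates
    on [V] determine. *)
Lemma representing_ae_eq (S : set X) (f g : X -> R) : mu.-negligible (~` S) ->
  E f -> E g -> (forall x, S x -> f x = g x) -> L f = L g.
Proof.
move=> S0 Ef Eg fg; apply: EFin_inj.
rewrite (mu_representing.2 _ Ef).2 (mu_representing.2 _ Eg).2.
apply: ae_eq_integral => //.
- by apply/measurable_EFinP; exact: continuous_borel (E_continuous Ef).
- by apply/measurable_EFinP; exact: continuous_borel (E_continuous Eg).
- by apply: negligibleS S0 => x /= /not_implyP[_ fgx] Sx; rewrite fg in fgx.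
Qed.

Lemma representing_ge0 (S : set X) (p : X -> R) : mu.-negligible (~` S) ->
  E p -> (forall x, S x -> 0 <= p x) -> 0 <= L p.
Proof.
move=> S0 Ep p0; rewrite -lee_fin (mu_representing.2 _ Ep).2.
by rewrite (ae_ge0_integral S0 p0 (E_continuous Ep)) integral_ge0.
Qed.

Lemma core_step_full : E 0 -> (exists2 f, E f & L f != 0) -> L 0 = 0 ->
  forall k, core_step E L k !=set0 /\ mu.-negligible (~` core_step E L k).
Proof.
(* On an empty carrier [f] and [0] would agree, forcing [L f = L 0 = 0]. *)
move=> E0 [f Ef Lf] L0.
have neq0 (S : set X) : mu.-negligible (~` S) -> S !=set0.
  move=> S0; apply/set0P/negP => /eqP Se; move/eqP: Lf; apply.
  rewrite -L0; apply: (representing_ae_eq S0) => // x.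
  by rewrite Se.
suff H k : mu.-negligible (~` core_step E L k).
  by move=> k; split; [exact: neq0|].
elim: k => [|k IH]; first by rewrite /= setCT; exact: negligible_set0.
rewrite core_stepS; last exact/set0P/neq0.
apply: radon_common_zeros => //; first by case: mu_representing.
- by move=> p [/E_continuous].
- move=> p [Ep Lp p0]; apply: (ae_integral_eq0 IH p0 (E_continuous Ep)).
  by rewrite -(mu_representing.2 _ Ep).2 Lp.
Qed.

End Representing.

(** * Equality of the set of atoms and the core variety *)

Lemma linear_on_sum (R : realType) (W : lmodType R) (E : set W) (L : W -> R)
    (m : nat) (c : 'I_m -> R) (b : 'I_m -> W) :
  GRing.submod_closed (mem E) -> linear_on E L -> (forall i, E (b i)) ->
  E (\sum_(i < m) c i *: b i) /\
  L (\sum_(i < m) c i *: b i) = \sum_(i < m) c i * L (b i).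
Proof.
move=> [/set_mem E0 EZ] Ll Eb.
have L0 : L 0 = 0.
  by have := Ll (-1) 0 0 E0 E0; rewrite scaler0 addr0 mulN1r addNr.
elim/big_rec2: _ => [//|i r s _ [Es <-]]; split; last by rewrite Ll.
by apply: set_mem; apply: EZ; exact: mem_set.
Qed.

Unset Implicit Arguments.

Theorem theorem32 (R : realType) (X : ptopologicalType)
    (X_locally_compact : locally_compact [set: X])
    (X_hausdorff : hausdorff_space X)
    (E : set (X -> R))
    (E_subspace : GRing.submod_closed (mem E))
    (E_fin_dim : finite_dimensional E)
    (E_continuous : forall f : X -> R, E f -> continuous f)
    (L : (X -> R) -> R)
    (L_linear : linear_on E L)
    (L_moment : moment_functional E L)
    (L_neq0 : exists2 f, E f & L f != 0) :
  atoms E L = core_variety E L.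
Proof.
have [E0 L0] : E 0 /\ L 0 = 0.
  have := @linear_on_sum R _ E L 0 (fun=> 0) (fun=> 0) E_subspace L_linear.
  by rewrite !big_ord0; apply; case.
apply/seteqP; split => x.
  (* An atom outside some step would be a point of positive mass in a negligible set. *)
  move=> [mu mur mux] k _; apply: contrapT => xk; move: mux.
  have [_ nk] := core_step_full X_hausdorff E_continuous mur E0 L_neq0 L0 k.
  have xS : [set x] `<=` ~` core_step E L k by move=> _ ->.
  have nx := @negligibleS _ (borel X) R mu _ _ xS nk.
  have mx := compact_borel X_hausdorff (@compact_set1 _ x).
  by rewrite (measure_negligible mx nx) ltxx.
move=> xV; have [|k Vk] := core_step_stable (L := L) E_fin_dim.
  by exists x.
have [mu mur] := L_moment.
have [/set0P V0 nV] :=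
  core_step_full X_hausdorff E_continuous mur E0 L_neq0 L0 k.
(* Stability now says that a [p] in [E] with [L p = 0], nonnegative on the stable step, vanishes on
   it. *)
rewrite core_stepS// in Vk.
set V := core_step E L k in Vk V0 nV.
have [m [b [Eb sb fb]]] := restricted_basis V E_fin_dim.
pose p (c : 'rV[R]_m) := \sum_(i < m) c 0 i *: b i.
have pE (c : 'rV[R]_m) t : p c t = (c *m (\col_i b i t)) 0 0.
  by rewrite /p fct_sumE mxE; apply: eq_bigr => i _; rewrite mxE.
pose y := \col_i L (b i).
have [Ep LpE] : (forall c, E (p c)) /\ forall c, L (p c) = (c *m y) 0 0.
  split=> c; have [Epc Lpc] := linear_on_sum (c 0) E_subspace L_linear Eb => //.
  by rewrite Lpc mxE; apply: eq_bigr => i _; rewrite mxE.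
(* In coordinates, [y] stands for [L] and the column of the [b i t] for evaluation at [t]. *)
have [|c c0 cV|n [t [l [e [e0 Vt l0 yE]]]]] :=
    @cone_interior R X m V (fun t => \col_i b i t) y x.
- exact: xV.
- have pc0 t : V t -> 0 <= p c t by rewrite pE; exact: cV.
  rewrite -LpE lt_neqAle (representing_ge0 E_continuous mur nV)// andbT.
  (* If [L (p c) = 0], stability makes [p c] vanish on [V], and independence on [V] gives
     [c = 0]. *)
  apply: contraNneq c0 => Lpc; apply/eqP/fb => t Vt.
  have pN : null_nonneg_on E L V (p c) by split.
  by have := Vk t Vt (p c) pN; rewrite {1}/p fct_sumE.
(* Index 0 carries [x] with mass [e], index [j.+1] carries [t j] with mass [l j]; the default values
   beyond [n] never enter the sum. *)
pose s i := if i is j.+1 then oapp t x (insub j) else x.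
pose w i : {nonneg R} := if i is j.+1
  then oapp (fun j => NngNum (l0 j)) (NngNum (lexx 0)) (insub j)
  else NngNum (ltW e0).
exists (atomic_measure n.+1 s w).
  split; first exact: atomic_measure_radon.
  move=> f Ef; have mf := continuous_borel (E_continuous f Ef).
  split; first exact: integrable_atomic_measure.
  rewrite integral_atomic_measure//; congr (_%:E).
  have [c fc] := sb f Ef.
  have fp z : V z -> f z = p c z by move=> /fc ->; rewrite /p fct_sumE.
  rewrite (representing_ae_eq E_continuous mur nV Ef (Ep c) fp) LpE yE.
  rewrite big_ord_recl/= fp; last exact: xV.
  rewrite mulmxDr -scalemxAr mulmx_sumr mxE [X in X + _]mxE -pE summxE.
  congr (_ + _); apply: eq_bigr => i _.
  rewrite -scalemxAr mxE -pE /bump /= add0n valK /= -fp//; exact: Vt.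
rewrite atomic_measureE big_ord_recl/= indicE mem_set// mule1.
apply: (@lt_le_trans _ _ e%:E); first by rewrite lte_fin.
by apply: leeDl; exact: sume_ge0.
Qed.
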